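(* The proof systems $\mathsf{QCDCL}^{\textsf{LEV-ORD}}_{\textsf{NO-RED}}$ and $\mathsf{QCDCL}^{\textsf{LEV-ORD}}_{\textsf{RED}}$ are incomparable, i.e., neither of them simulates the other: there are false QCNFs with polynomial-size refutations in one of the systems that require super-polynomial-size refutations in the other, in both directions.
   Context: QBF basics. A literal is a variable $x$ or $\bar x$; a clause is a disjunction of literals identified with its set of literals; $(\bot)$ is the empty clause. A QCNF is $\Phi=\mathcal{Q}\cdot\phi$ with prefix $\mathcal{Q}=Q_1X_1\dots Q_sX_s$ (disjoint nonempty variable sets, alternating $Q_i\in\{\exists,\forall\}$) and matrix $\phi$ a CNF of non-tautological clauses. $\mathrm{lv}(x)=i$ if the variable of $x$ is in $X_i$; existential/universal variables are those in $\exists$/$\forall$-blocks. $\mathrm{red}(C)$ deletes from $C$ every universal literal $v$ with $\mathrm{lv}(v)>\mathrm{lv}(x)$ for all existential $x\in C$. For existential $\ell$ not occurring (as variable) in $C_1,C_2$: $(C_1\vee\ell)\otimes_\ell(C_2\vee\bar\ell)=C_1\vee C_2$. QCDCL. $C|_\sigma=\top$ if $C\cap\sigma\neq\emptyset$, else the clause of all $\ell\in C$ with $\bar\ell\notin\sigma$. A trail for $\Phi=\mathcal{Q}\cdot\phi$ is $\mathcal{T}=(p_{(0,1)},\dots,p_{(0,g_0)};d_1,p_{(1,1)},\dots,p_{(1,g_1)};\dots;d_r,p_{(r,1)},\dots,p_{(r,g_r)})$, a sequence of literals with no variable occurring twice; $d_i$ decision literals, $p_{(i,j)}$ propagated literals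 (existential, or $\bot$ only as last element: a conflict). $\mathcal{T}[s,t]$: initial segment ending at $p_{(s,t)}$ (at $d_s$ if $t=0$; $\mathcal{T}[0,0]$ empty); $|\mathcal{T}|$: number of elements. Each $p_{(i,j)}$ has an antecedent $\mathrm{ante}(p_{(i,j)})\in\phi$ with: under RED, $\mathrm{red}(\mathrm{ante}(p_{(i,j)})|_{\mathcal{T}[i,j-1]})=(p_{(i,j)})$; under NO-RED, $\mathrm{ante}(p_{(i,j)})|_{\mathcal{T}[i,j-1]}=(p_{(i,j)})$ ($(\bot)$ = empty clause). Decision policy LEV-ORD: $\mathrm{lv}(d_i)\le\mathrm{lv}(x)$ for all variables $x$ of $\phi$ unassigned in $\mathcal{T}[i-1,g_{i-1}]$. A clause $C$ is unit under RED if $\mathrm{red}(C)=(x)$, $x$ existential, or $\mathrm{red}(C)$ empty ($x=\bot$); under NO-RED if $C=(x)$, $x$ existential, or $C$ empty. Natural condition at an initial segment without $\bot$: if some clauses of the current clause set are unit under it, the next element is the literal of one of them with that clause as antecedent, and is $\bot$ if possible; natural trail: holds everywhere. Learnable clauses of a trail ending in $\bot$: $C_{(r,g_r)}=\mathrm{red}(\mathrm{ante}(\bot))$; leftwards over propagated $p$, with $C'$ the clause of the next propagated literal to the right, the clause of $p$ is $\mathrm{red}(C'\otimes_p\mathrm{red}(\mathrm{ante}(p)))$ if $\bar p\in C'$, else $C'$; $\mathcal{L}_\mathcal{T}$ is this sequence. A $\mathsf{QCDCL}^{\textsf{LEV-ORD}}_{R}$ proof of $C$ from $\Phi$ is $((\mathcal{T}_1,\dots,\mathcal{T}_m),(C_1,\dots,C_m),(\pi_1,\dots,\pi_m))$: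 each $\mathcal{T}_i$ a trail following LEV-ORD and $R$ for $\mathcal{Q}\cdot(\phi\cup\{C_1,\dots,C_{i-1}\})$ that has run into a conflict, $C_i\in\mathcal{L}_{\mathcal{T}_i}$ with its derivation $\pi_i$, $C_m=C$, $\mathcal{T}_1$ natural, and for $i\ge2$ some $(s,t)$ with $\mathcal{T}_i[s,t]=\mathcal{T}_{i-1}[s,t]$ such that $\mathcal{T}_i$ satisfies the natural condition at all initial segments extending $\mathcal{T}_i[s,t]$. Refutation if $C=(\bot)$; size $\sum_i|\mathcal{T}_i|$. A system $g$ simulates $f$ if every $f$-proof can be transformed into a $g$-proof of the same formula of polynomially related size. *)

(* Defs.v *)
From mathcomp Require Export all_boot all_order all_algebra.
From mathcomp Require Export finmap.

Set Implicit Arguments.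
Unset Strict Implicit.
Unset Printing Implicit Defensive.

Local Open Scope fset_scope.

(* (x, true) is the literal x and (x, false) its negation. *)
Definition lit : Type := (nat * bool)%type.
Definition neg (l : lit) : lit := (l.1, ~~ l.2).

Definition clause : Type := {fset lit}.
Definition cnf : Type := {fset clause}.

Inductive quantifier := QEx | QAll.
Definition is_ex (q : quantifier) : bool := if q is QEx then true else false.

Definition block : Type := (quantifier * {fset nat})%type.
Definition prefix_of_blocks : Type := seq block.

Definition tautological (C : clause) : bool :=
  has (fun l => neg l \in C) (enum_fset C).

Record qcnf := QCNF {
  qprefix : prefix_of_blocks;
  qmatrix : cnf;
  qprefix_nonempty : all (fun B : block => B.2 != fset0) qprefix;
  qprefix_disjoint :
    pairwise (fun B B' : block => [disjoint B.2 & B'.2]) qprefix;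
  qprefix_alternating :
    sorted (fun B B' : block => is_ex B.1 != is_ex B'.1) qprefix;
  qmatrix_closed : forall (C : clause) (l : lit),
    C \in qmatrix -> l \in C -> has (fun B : block => l.1 \in B.2) qprefix;
  qmatrix_nontaut : forall C : clause, C \in qmatrix -> ~~ tautological C
}.

Definition qcnf_size (Phi : qcnf) : nat :=
  \sum_(B <- qprefix Phi) #|` B.2| + \sum_(C <- qmatrix Phi) (#|` C|).+1.

Fixpoint qtrue_under (Q : prefix_of_blocks) (phi : cnf) (s : nat -> bool) :
    Prop :=
  match Q with
  | [::] => forall C : clause, C \in phi -> exists2 l : lit, l \in C & s l.1 = l.2
  | (QEx, X) :: Q' =>
      exists t, (forall x, x \notin X -> t x = s x) /\ qtrue_under Q' phi t
  | (QAll, X) :: Q' =>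
      forall t, (forall x, x \notin X -> t x = s x) -> qtrue_under Q' phi t
  end.

(* The initial valuation is irrelevant, since the formula is closed. *)
Definition qtrue (Phi : qcnf) : Prop :=
  qtrue_under (qprefix Phi) (qmatrix Phi) (fun _ => false).

Definition qfalse (Phi : qcnf) : Prop := ~ qtrue Phi.

Section Prefix.
Variable Q : prefix_of_blocks.

Definition bound (x : nat) : bool := has (fun B : block => x \in B.2) Q.
Definition lv (x : nat) : nat := (find (fun B : block => x \in B.2) Q).+1.
Definition existential (x : nat) : bool :=
  has (fun B : block => is_ex B.1 && (x \in B.2)) Q.
Definition universal (x : nat) : bool :=
  has (fun B : block => ~~ is_ex B.1 && (x \in B.2)) Q.

Definition red (C : clause) : clause :=
  [fset v in C | ~~ (universal v.1 &&
     all (fun x : lit => existential x.1 ==> (lv x.1 < lv v.1)) (enum_fset C))].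

(* [resolve p C D] is the resolvent of C (containing the negation of p) with
   D (containing p). *)
Definition resolve (p : lit) (C D : clause) : clause :=
  (C `\ neg p) `|` (D `\ p).

(* [None] stands for the satisfied clause (top). *)
Definition restrict (C : clause) (sigma : seq lit) : option clause :=
  if has (fun l => l \in sigma) (enum_fset C) then None
  else Some [fset l in C | neg l \notin sigma].

Inductive reduction_policy := RED | NO_RED.

(* A propagated element is a literal or bottom, the latter being [None]. *)
Definition clause_of_element (p : option lit) : clause :=
  if p is Some l then [fset l] else fset0.

Definition unit_clause (R : reduction_policy) (C : clause) (p : option lit) :
    Prop :=
  (if R is RED then red C else C) = clause_of_element p /\
  (forall l, p = Some l -> existential l.1).

Definition unit_under (R : reduction_policy) (C : clause) (sigma : seq lit)
    (p : option lit) : Prop :=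
  exists2 D, restrict C sigma = Some D & unit_clause R D p.

(* A trail is stored as its sequence of elements, each one marked as a decision
   or as a propagation, the latter together with its antecedent.  The initial
   segments T[s, t] are exactly the [take k T] with [k <= size T]. *)
Inductive step :=
| Decide of lit
| Propagate of option lit & clause.

Definition trail : Type := seq step.

(* [(true, l)] is a decision, [(false, p)] a propagation; the antecedents are
   forgotten. *)
Definition step_element (e : step) : bool * option lit :=
  match e with
  | Decide l => (true, Some l)
  | Propagate p _ => (false, p)
  end.

Definition elements (T : trail) : seq (bool * option lit) := map step_element T.

Definition assignment (T : trail) : seq lit :=
  pmap (fun e => (step_element e).2) T.

Definition assigned (T : trail) : seq nat := [seq l.1 | l <- assignment T].

Definition conflict_in (T : trail) : bool := (false, None) \in elements T.

Definition conflicting (T : trail) : Prop :=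
  exists T' A, T = rcons T' (Propagate None A).

Definition lev_ord (phi : cnf) (T : trail) (d : lit) : Prop :=
  forall (C : clause) (l : lit), C \in phi -> l \in C ->
    l.1 \notin assigned T -> lv d.1 <= lv l.1.

Definition is_trail (R : reduction_policy) (phi : cnf) (T : trail) : Prop :=
  [/\ uniq (assigned T),
      forall k d, onth T k = Some (Decide d) ->
        bound d.1 /\ lev_ord phi (take k T) d,
      forall k p A, onth T k = Some (Propagate p A) ->
        A \in phi /\ unit_under R A (assignment (take k T)) p
    & forall k A, onth T k = Some (Propagate None A) -> k.+1 = size T].

Definition natural_at (R : reduction_policy) (phi : cnf) (T : trail) (k : nat) :
    Prop :=
  let sigma := assignment (take k T) in
  ~~ conflict_in (take k T) ->
  (exists C p, C \in phi /\ unit_under R C sigma p) ->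
  exists p A,
    [/\ onth T k = Some (Propagate p A), A \in phi, unit_under R A sigma p
      & (exists2 C, C \in phi & unit_under R C sigma None) -> p = None].

Definition natural_from (R : reduction_policy) (phi : cnf) (T : trail)
    (k : nat) : Prop :=
  forall j, k <= j <= size T -> natural_at R phi T j.

(* [T] is read from right to left and [C] is the clause of the propagated
   element just passed. *)
Fixpoint learn_leftwards (C : clause) (T : trail) : seq clause :=
  match T with
  | Propagate (Some p) A :: T' =>
      let C' := if neg p \in C then red (resolve p C (red A)) else C in
      C' :: learn_leftwards C' T'
  | _ :: T' => learn_leftwards C T'
  | [::] => [::]
  end.

Definition learnable (T : trail) : seq clause :=
  match rev T with
  | Propagate None A :: T' => red A :: learn_leftwards (red A) T'
  | _ => [::]
  end.

End Prefix.

(* The derivation of a learned clause is the initial part, ending in that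
   clause, of the sequence of learnable clauses. *)
Record round := Round {
  round_trail : trail;
  round_clause : clause;
  round_deriv : seq clause
}.

Definition learned (rs : seq round) : cnf :=
  [fset C in [seq round_clause r | r <- rs]].

Definition valid_round (R : reduction_policy) (Q : prefix_of_blocks) (phi : cnf)
    (previous : option round) (r : round) : Prop :=
  let T := round_trail r in
  [/\ is_trail Q R phi T,
      conflicting T,
      prefix (round_deriv r) (learnable Q T) /\
        (exists D, round_deriv r = rcons D (round_clause r))
    & if previous is Some r' then
        exists k, [/\ k <= size T, k <= size (round_trail r'),
          elements (take k T) = elements (take k (round_trail r'))
          & natural_from Q R phi T k]
      else natural_from Q R phi T 0].

(* QCDCL with decision policy LEV-ORD and reduction policy [R]. *)
Definition qcdcl_proof (R : reduction_policy) (Phi : qcnf) (C : clause)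
    (P : seq round) : Prop :=
  (forall i r, onth P i = Some r ->
     valid_round R (qprefix Phi) (qmatrix Phi `|` learned (take i P))
       (if i is j.+1 then onth P j else None) r) /\
  (exists P' r, P = rcons P' r /\ round_clause r = C).

Definition qcdcl_refutation (R : reduction_policy) (Phi : qcnf)
    (P : seq round) : Prop := qcdcl_proof R Phi fset0 P.

Definition proof_size (P : seq round) : nat :=
  \sum_(r <- P) size (round_trail r).

(* The system with policy [R'] simulates the system with policy [R]. *)
Definition simulates (R' R : reduction_policy) : Prop :=
  exists p : {poly nat}, forall (Phi : qcnf) (P : seq round),
    qcdcl_refutation R Phi P ->
    exists2 P', qcdcl_refutation R' Phi P' &
      proof_size P' <= horner p (proof_size P).

Definition poly_size_refutations (R : reduction_policy) (Phi : nat -> qcnf) :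
    Prop :=
  exists p : {poly nat}, forall n, exists2 P, qcdcl_refutation R (Phi n) P &
    proof_size P <= horner p (qcnf_size (Phi n)).

Definition superpoly_size_refutations (R : reduction_policy)
    (Phi : nat -> qcnf) : Prop :=
  forall q : {poly nat}, exists N, forall n, N <= n ->
    forall P, qcdcl_refutation R (Phi n) P ->
      horner q (qcnf_size (Phi n)) < proof_size P.

(* Main.v *)
Require Import Defs.
From mathcomp Require Import zify.

(** Both separations use the prefix ∃x_1..x_m ∀u ∃a_1..a_m ∀w ∃t and the hard
    clauses (±x_i ∨ ±u ∨ a_i), (±u ∨ ¬a_1 ∨ .. ∨ ¬a_m), next to clauses in w and
    t alone that are trivial to refute but are only reached once w is decided.

    Adding ¬w to the hard clauses and taking the clauses (w ∨ t), (w ∨ ¬t) gives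
    the formulas that are easy without reduction: the literal ¬w blocks every
    propagation, so one may decide everything up to w = 0 and learn the empty
    clause at once.  Under reduction ¬w is dropped, and some hard clause is
    falsified before w can be decided.  Taking the hard clauses as they are
    together with (w) gives the formulas that are easy under reduction, since
    (w) reduces to the empty clause, whereas without reduction w is again never
    reached.

    In the hard direction a trail assigns all of x before u and the a_i, so
    conflict analysis resolves over the a_i first.  As long as only the a_i have
    been resolved, a clause free of them mentions every x_i and hence excludes
    one assignment of x only.  Each trail contributes at most one such clause,
    and the empty clause excludes all 2^m assignments. *)

Set Implicit Arguments.
Unset Strict Implicit.
Unset Printing Implicit Defensive.

Local Open Scope fset_scope.
Local Open Scope nat_scope.

(** * Literals, reduction, restriction and unit clauses *)

Lemma negK (l : lit) : neg (neg l) = l.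
Proof. by case: l => x b; rewrite /neg /= negbK. Qed.

Lemma clause_ext (C D : clause) :
  (forall l : lit, (l \in C) = (l \in D)) -> C = D.
Proof. by move=> eCD; apply/fsetP. Qed.

Lemma in_red Q C (v : lit) :
  (v \in red Q C) = (v \in C) && ~~ (universal Q v.1 &&
     all (fun x : lit => existential Q x.1 ==> (lv Q x.1 < lv Q v.1))
       (enum_fset C)).
Proof. by rewrite /red !inE. Qed.

Lemma red_sub Q C : {subset red Q C <= C}.
Proof. by move=> v; rewrite in_red => /andP[]. Qed.

Lemma red_nonuniversal Q C (v : lit) : v \in C -> ~~ universal Q v.1 -> v \in red Q C.
Proof. by move=> vC /negPf vU; rewrite in_red vC vU. Qed.

Lemma red_blocked Q C (v q : lit) :
  v \in C -> q \in C -> existential Q q.1 -> lv Q v.1 <= lv Q q.1 ->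
  v \in red Q C.
Proof.
move=> vC qC qE le; rewrite in_red vC /=; apply/negP => /andP[_ /allP/(_ _ qC)].
by rewrite qE /= ltnNge le.
Qed.

Lemma red_drop Q C (v : lit) :
  universal Q v.1 ->
  (forall q : lit, q \in C -> existential Q q.1 -> lv Q q.1 < lv Q v.1) ->
  v \notin red Q C.
Proof.
move=> vU lt; rewrite in_red vU /= negb_and negbK; apply/orP; right.
by apply/allP => q qC; apply/implyP; apply: lt.
Qed.

Lemma in_resolve p C D (l : lit) : (l \in resolve p C D) =
  (l != neg p) && (l \in C) || (l != p) && (l \in D).
Proof. by rewrite !inE. Qed.

Lemma restrictP C sigma D : restrict C sigma = Some D ->
  (forall l : lit, l \in C -> l \notin sigma) /\
  (forall l : lit, (l \in D) = (l \in C) && (neg l \notin sigma)).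
Proof.
rewrite /restrict; case: ifPn => // /hasPn nC [<-]; split=> // l.
by rewrite !inE.
Qed.

Lemma restrict_eq (C D : clause) (sigma : seq lit) :
  (forall l : lit, l \in C -> l \notin sigma) ->
  (forall l : lit, (l \in D) = (l \in C) && (neg l \notin sigma)) ->
  restrict C sigma = Some D.
Proof.
move=> nC inD; rewrite /restrict ifN; last exact/hasPn.
by congr Some; apply: clause_ext => l; rewrite inD !inE.
Qed.

(** Reduction deletes universal literals only, so under either policy any other literal surviving
    the restriction is the unit itself. *)
Lemma unit_under_nonuniversal Q R C sigma p (l : lit) : unit_under Q R C sigma p ->
  l \in C -> ~~ universal Q l.1 -> neg l \in sigma \/ p = Some l.
Proof.
case=> D /restrictP[_ inD] [eqD _] lC lU.
case: (boolP (neg l \in sigma)) => ls; [by left | right].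
have lD : l \in D by rewrite inD lC.
have : l \in clause_of_element p.
  by rewrite -eqD; case: R {eqD} => //; apply: red_nonuniversal.
by case: p {eqD} => [q|]; rewrite ?inE // => /eqP ->.
Qed.

Lemma unit_under_in Q R C sigma q : unit_under Q R C sigma (Some q) ->
  [/\ q \in C, existential Q q.1 & neg q \notin sigma].
Proof.
case=> D /restrictP[_ inD] [eqD /(_ _ erefl) qE].
have : q \in clause_of_element (Some q) by rewrite inE.
rewrite -eqD => qR.
have : q \in D by case: R {eqD} qR => // /red_sub.
by rewrite inD => /andP[].
Qed.

(** The existential unit [q] blocks the reduction of literals at its level or to the left, universal
    ones included. This is what forces u to be assigned before an a-variable is propagated. *)
Lemma unit_under_low Q R C sigma q (l : lit) : unit_under Q R C sigma (Some q) ->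
  l \in C -> lv Q l.1 <= lv Q q.1 -> neg l \in sigma \/ l = q.
Proof.
move=> UC lC le; have [qC qE nq] := unit_under_in UC.
case: UC => D /restrictP[_ inD] [eqD _].
case: (boolP (neg l \in sigma)) => ls; [by left | right].
have lD : l \in D by rewrite inD lC.
have qD : q \in D by rewrite inD qC.
have : l \in clause_of_element (Some q).
  by rewrite -eqD; case: R {eqD} => //; apply: red_blocked le.
by rewrite inE => /eqP.
Qed.

(** * Assignments of trails and their consistency *)

Lemma assignment_cat T T' : assignment (T ++ T') = assignment T ++ assignment T'.
Proof. exact: pmap_cat. Qed.

Lemma assigned_cat T T' : assigned (T ++ T') = assigned T ++ assigned T'.
Proof. by rewrite /assigned assignment_cat map_cat. Qed.

Lemma uniq_var_consistent (sigma : seq lit) (l : lit) :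
  uniq [seq k.1 | k <- sigma] -> l \in sigma -> neg l \notin sigma.
Proof.
elim: sigma => //= k s IH /andP[ks us]; rewrite !inE => /orP[/eqP lk|ls].
  rewrite -lk negb_or; apply/andP; split.
    by apply/eqP; case: (l) => x [].
  by rewrite -lk in ks; apply: contra ks => nl; apply/mapP; exists (neg l).
rewrite negb_or IH // andbT; apply: contra ks => /eqP <-.
by apply/mapP; exists l.
Qed.

Lemma var_in (sigma : seq lit) x b : x \in [seq k.1 | k <- sigma] ->
  (x, b) \in sigma \/ (x, ~~ b) \in sigma.
Proof.
by case/mapP=> -[y c] + ->; case: b; case: c => ?; [left|right|right|left].
Qed.

Definition varange (lo k : nat) : {fset nat} := [fset x in iota lo k].

Lemma in_varange lo k x : (x \in varange lo k) = (lo <= x < lo + k).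
Proof. by rewrite !inE mem_iota. Qed.

(** * The formulas *)

(* Variables: x_i is [i], u is [m], a_i is [m.+1 + i], w is [m.*2.+1] and t is
   [m.*2.+2], for [i < m]. *)
Definition blocks (m : nat) : prefix_of_blocks :=
  [:: (QEx, varange 0 m); (QAll, varange m 1); (QEx, varange m.+1 m);
      (QAll, varange m.*2.+1 1); (QEx, varange m.*2.+2 1)].

Lemma lvE m x : lv (blocks m) x =
  if x < m then 1 else if x == m then 2 else if x <= m.*2 then 3
  else if x == m.*2.+1 then 4 else if x == m.*2.+2 then 5 else 6.
Proof. by rewrite /lv /= !in_varange; do !case: ifP => ? //; lia. Qed.

Lemma existentialE m x : existential (blocks m) x =
  (x < m) || (m < x <= m.*2) || (x == m.*2.+2).
Proof. by rewrite /existential /= !in_varange; lia. Qed.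

Lemma universalE m x :
  universal (blocks m) x = (x == m) || (x == m.*2.+1).
Proof. by rewrite /universal /= !in_varange; lia. Qed.

Lemma lv_mono m x y : x <= y -> lv (blocks m) x <= lv (blocks m) y.
Proof. by rewrite !lvE; do !case: ifP => //; lia. Qed.

Lemma lv_lt_universal m x y :
  universal (blocks m) y -> (lv (blocks m) x < lv (blocks m) y) = (x < y).
Proof. by rewrite universalE !lvE; do !case: ifP => //; lia. Qed.

Definition xclause (m i : nat) (b c : bool) : clause :=
  [fset (i, b); (m, c); (m.+1 + i, true)].

Definition aclause (m : nat) (c : bool) : clause :=
  (m, c) |` [fset l in [seq (y, false) | y <- iota m.+1 m]].

Definition hard (m : nat) : seq clause :=
  flatten [seq [:: xclause m i true true; xclause m i true false;
                   xclause m i false true; xclause m i false false]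
          | i <- iota 0 m] ++ [:: aclause m true; aclause m false].

(** Both families are instances, so that one lower bound covers them: [g] is the guard ¬w or
    nothing, and [trap] holds the easily refuted clauses in w and t. *)
Definition guarded (m : nat) (g : clause) (trap : seq clause) : cnf :=
  [fset C in [seq h `|` g | h <- hard m] ++ trap].

Lemma in_xclause m i b c (l : lit) : (l \in xclause m i b c) =
  [|| l == (i, b), l == (m, c) | l == (m.+1 + i, true)].
Proof. by rewrite !inE -orbA. Qed.

Lemma in_aclause m c (l : lit) :
  (l \in aclause m c) = (l == (m, c)) || (m < l.1 <= m.*2) && ~~ l.2.
Proof.
rewrite !inE; congr orb; apply/mapP/andP => [[y yI ->]|[l1 l2]].
  by rewrite mem_iota in yI; split=> //=; lia.
by exists l.1; [rewrite mem_iota; lia | case: l l2 {l1} => x []].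
Qed.

Lemma hardP m h : reflect
  ((exists i b c, i < m /\ h = xclause m i b c) \/ exists c, h = aclause m c)
  (h \in hard m).
Proof.
rewrite mem_cat; apply: (iffP orP) => -[].
- case/flattenP=> s /mapP[i]; rewrite mem_iota => im ->; rewrite !inE => H.
  left; case/or4P: H => /eqP ->; exists i.
  + by exists true, true.
  + by exists true, false.
  + by exists false, true.
  + by exists false, false.
- by rewrite !inE => /orP[]/eqP ->; right; [exists true | exists false].
- case=> i [b [c [im ->]]]; left; apply/flattenP.
  exists [:: xclause m i true true; xclause m i true false;
             xclause m i false true; xclause m i false false].
    by apply/mapP; exists i; rewrite // mem_iota.
  by case: b; case: c; rewrite !inE eqxx ?orbT.
- by case=> -[] ->; right; rewrite !inE eqxx ?orbT.
Qed.

Lemma in_guarded m g trap C : reflect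
  ((exists2 h, h \in hard m & C = h `|` g) \/ C \in trap)
  (C \in guarded m g trap).
Proof.
have -> : (C \in guarded m g trap) = (C \in [seq h `|` g | h <- hard m] ++ trap).
  by rewrite /guarded in_fset.
rewrite mem_cat; apply: (iffP orP) => -[H|]; try by right.
  by left; case/mapP: H => h hh ->; exists h.
by left; case: H => h hh ->; apply/mapP; exists h.
Qed.

(** * The lower bound *)

(* The literals x_i, ~x_i, ~a_i, and a_j for j <> i.  Every hard clause contains
   one of them and, the set being consistent on the a-variables, so does every
   resolvent over these; without a-variables it can only be x_i or ~x_i. *)
Definition probe (m i : nat) (l : lit) : bool :=
  (l.1 == i) || (m < l.1 <= m.*2) && (l.2 == (l.1 != m.+1 + i)).

(** [W] holds the assignments of x that such a clause may exclude, so its cardinality measures the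
    progress of a refutation. *)
Definition xtype (m : nat) (W : {set {ffun 'I_m -> bool}}) (C : clause) : Prop :=
  (forall l : lit, l \in C -> l.1 < m) /\
  (forall s : {ffun 'I_m -> bool}, s \notin W ->
     exists i : 'I_m, (nat_of_ord i, s i) \in C).

(** The shape of hard clauses, kept by resolution over a-variables as long as an a-variable remains.
    The bound on variables admits the guard w but not t. *)
Record gtype (m : nat) (C : clause) : Prop := GType {
  gtype_vars : forall l : lit, l \in C -> l.1 <= m.*2.+1;
  gtype_u : exists2 l : lit, l \in C & l.1 = m;
  gtype_a : exists2 l : lit, l \in C & m < l.1 <= m.*2;
  gtype_probe : forall i, i < m -> exists2 l : lit, l \in C & probe m i l
}.

Lemma xtypeS m (W W' : {set {ffun 'I_m -> bool}}) C :
  W \subset W' -> xtype W C -> xtype W' C.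
Proof.
move=> /subsetP sW [vC sC]; split=> // s sW'; apply: sC.
by apply: contra sW'; apply: sW.
Qed.

(** The clause for x_i meets probe i in its x-literal and every other probe in a_i; the long clause
    contains ¬a_j for every j. *)
Lemma gtype_hard m g h : 0 < m -> (forall l : lit, l \in g -> l.1 = m.*2.+1) ->
  h \in hard m -> gtype m (h `|` g).
Proof.
move=> m0 Hg /hardP[[i [b [c [im ->]]]]|[c ->]]; split.
- move=> l; rewrite in_fsetU in_xclause => /orP[/or3P[]/eqP->|/Hg ->] //=; lia.
- by exists (m, c) => //; rewrite in_fsetU in_xclause eqxx orbT.
- exists (m.+1 + i, true); last by simpl; lia.
  by rewrite in_fsetU in_xclause eqxx !orbT.
- move=> j jm; case: (eqVneq j i) => [->|nji].
    exists (i, b); first by rewrite in_fsetU in_xclause eqxx.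
    by apply/orP; left.
  exists (m.+1 + i, true); first by rewrite in_fsetU in_xclause eqxx !orbT.
  by rewrite /probe /=; lia.
- move=> l; rewrite in_fsetU in_aclause.
  move=> /orP[/orP[/eqP->|/andP[]]|/Hg ->] //=; lia.
- by exists (m, c) => //; rewrite in_fsetU in_aclause eqxx.
- have am : m < (m.+1, false).1 <= m.*2 by simpl; lia.
  by exists (m.+1, false); rewrite // in_fsetU in_aclause am orbT.
- move=> j jm; have am : m < (m.+1 + j, false).1 <= m.*2 by simpl; lia.
  exists (m.+1 + j, false); first by rewrite in_fsetU in_aclause am orbT.
  by rewrite /probe am /= eqxx orbT.
Qed.

(** The remaining a-literal lies to the right of u and blocks its reduction; the probe literals are
    existential. Only the guard may disappear. *)
Lemma red_gtype m C (C' := red (blocks m) C) :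
  gtype m C -> gtype m C'.
Proof.
case=> vC [u uC um] [a aC am] pC; split.
- by move=> l /red_sub; apply: vC.
- exists u => //; apply: (red_blocked uC aC); first by rewrite existentialE; lia.
  by apply: lv_mono; lia.
- by exists a => //; apply: red_nonuniversal => //; rewrite universalE; lia.
- move=> i im; have [l lC lp] := pC i im; exists l => //.
  apply: red_nonuniversal => //; rewrite universalE; move: lp; rewrite /probe; lia.
Qed.

Lemma red_xvars m C : (forall l : lit, l \in C -> l.1 < m) -> red (blocks m) C = C.
Proof.
move=> vC; apply: clause_ext => l; apply/idP/idP => [/red_sub //|lC].
by apply: red_nonuniversal => //; have := vC _ lC; rewrite universalE; lia.
Qed.

(** Soundness of resolution: one assignment cannot satisfy both pivot literals, so one of the two
    satisfied literals survives. *)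
Lemma resolve_xtype m (W : {set {ffun 'I_m -> bool}}) p C D :
  xtype W C -> xtype W D -> xtype W (resolve p C D).
Proof.
move=> [vC sC] [vD sD]; split.
  by move=> l; rewrite !inE => /orP[]/andP[_]; [apply: vC | apply: vD].
move=> s sW; have [i iC] := sC s sW; have [j jD] := sD s sW.
case: (eqVneq (nat_of_ord i, s i) (neg p)) => [eC|nC]; last first.
  by exists i; rewrite !inE nC iC.
case: (eqVneq (nat_of_ord j, s j) p) => [eD|nD]; last first.
  by exists j; rewrite !inE nD jD orbT.
move: eC eD; case: p => x b [ix sx] [jx sy].
have ij : i = j by apply: val_inj; rewrite /= ix jx.
by move: sx sy; rewrite ij => ->; case: b.
Qed.

Lemma falsified_literal (sigma : seq lit) x :
  uniq [seq k.1 | k <- sigma] -> x \in [seq k.1 | k <- sigma] ->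
  exists b, (x, ~~ b) \in sigma /\ (x, b) \notin sigma.
Proof.
move=> us; case/mapP=> -[y c] yc ->; exists (~~ c); rewrite negbK; split=> //.
exact: (uniq_var_consistent us yc).
Qed.

(** * Splitting a trail at one of its steps *)

Lemma assigned_mem T (l : lit) : l \in assignment T -> l.1 \in assigned T.
Proof. by move=> lT; apply/mapP; exists l. Qed.

Lemma assignment_rcons T e :
  assignment (rcons T e) = assignment T ++ seq_of_opt (step_element e).2.
Proof.
by rewrite -cats1 assignment_cat /assignment /=; case: (step_element e).2.
Qed.

Lemma trail_decide Q R phi T T1 d T2 : is_trail Q R phi T ->
  T = T1 ++ Decide d :: T2 -> bound Q d.1 /\ lev_ord Q phi T1 d.
Proof.
case=> _ H _ _ eT; have := H (size T1) d.
by rewrite eT onth_cat ltnn subnn take_size_cat //=; apply.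
Qed.

Lemma trail_propagate Q R phi T T1 p A T2 : is_trail Q R phi T ->
  T = T1 ++ Propagate p A :: T2 ->
  A \in phi /\ unit_under Q R A (assignment T1) p.
Proof.
case=> _ _ H _ eT; have := H (size T1) p A.
by rewrite eT onth_cat ltnn subnn take_size_cat //=; apply.
Qed.

Lemma onth_take (S : Type) (s : seq S) k i : i < k -> onth (take k s) i = onth s i.
Proof. by move=> ik; rewrite !onthE map_take nth_take. Qed.

Lemma onth_split (S : Type) (s : seq S) k e : onth s k = Some e ->
  s = take k s ++ e :: drop k.+1 s.
Proof.
move=> ek; have ks : k < size s by rewrite -onthTE ek.
by rewrite -{1}(cat_take_drop k s) (drop_nth e ks) (onth_nth e e s k ek).
Qed.

Lemma assignment_elements T : assignment T = pmap snd (elements T).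
Proof. by elim: T => //= e T <-. Qed.

Lemma size_le_sum (S : Type) (f : S -> nat) (s : seq S) :
  (forall i x, onth s i = Some x -> 0 < f x) -> size s <= \sum_(x <- s) f x.
Proof.
elim: s => //= x s IH H; rewrite big_cons.
have := H 0 x erefl; have := IH (fun i y => H i.+1 y); lia.
Qed.

(** * Hard clauses under a partial assignment *)

Section LowerBound.

Variables (R : reduction_policy) (m : nat) (g : clause) (trap : seq clause).
Hypothesis m_gt0 : 0 < m.
Hypothesis guard_var : forall l : lit, l \in g -> l.1 = m.*2.+1.
Hypothesis guard_no_red : R = NO_RED -> g = fset0.
Hypothesis trap_vars : forall (C : clause) (l : lit),
  C \in trap -> l \in C -> m.*2 < l.1.
Hypothesis trap_not_unit :
  forall (C : clause) p, C \in trap -> ~ unit_clause (blocks m) R C p.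

(** The guard never hinders propagation here: w lies to the right of every existential variable
    left, so under RED it is reduced away, and under NO-RED there is no guard. *)
Lemma hard_unit (h : clause) (sigma : seq lit) p : h \in hard m ->
  (forall l : lit, l \in sigma -> l.1 <= m.*2) ->
  (forall l : lit, l \in h -> l \notin sigma) ->
  (forall l : lit, (l \in h) && (neg l \notin sigma) = (l \in clause_of_element p)) ->
  (forall l, p = Some l -> existential (blocks m) l.1 /\ l.1 <= m.*2) ->
  exists2 C : clause, C \in guarded m g trap & unit_under (blocks m) R C sigma p.
Proof.
move=> hh small nh Dh pE; exists (h `|` g).
  by apply/in_guarded; left; exists h.
have ng (l : lit) : l \in g -> l \notin sigma.
  by move=> /guard_var lw; apply/negP => /small; rewrite lw; lia.
have nng (l : lit) : l \in g -> neg l \notin sigma.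
  by move=> /guard_var lw; apply/negP => /small; rewrite /= lw; lia.
exists (clause_of_element p `|` g).
  apply: restrict_eq => l; first by rewrite inE => /orP[/nh|/ng].
  rewrite !inE -Dh.
  by case: (boolP (l \in g)) => lg; rewrite ?(nng _ lg) ?orbT ?orbF.
split; last by move=> l /pE[].
case ER: R => /=; last by rewrite guard_no_red // fsetU0.
have small_p (l : lit) : l \in clause_of_element p ->
    existential (blocks m) l.1 /\ l.1 <= m.*2.
  by case: p {Dh} pE => [q|] pE; rewrite inE // => /eqP ->; apply: pE.
apply: clause_ext => l; apply/idP/idP => [lr|lp]; last first.
  apply: red_nonuniversal; first by rewrite inE lp.
  by have [] := small_p _ lp; rewrite existentialE universalE; lia.
move: (red_sub lr); rewrite inE => /orP[//|lg].
have lw := guard_var lg; have lu : universal (blocks m) l.1 by rewrite universalE; lia.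
suff /negP : l \notin red (blocks m) (clause_of_element p `|` g) by [].
apply: red_drop => // q; rewrite inE lv_lt_universal //.
case/orP=> [/small_p[_ ?] _|/guard_var]; first by lia.
by rewrite existentialE; lia.
Qed.

(** Among the four clauses for x_i, the one whose x_i- and u-literals are both falsified by [sigma]
    is left with a_i. *)
Lemma hard_propagates (sigma : seq lit) i : i < m ->
  uniq [seq k.1 | k <- sigma] ->
  (forall l : lit, l \in sigma -> l.1 <= m.*2) ->
  i \in [seq k.1 | k <- sigma] -> m \in [seq k.1 | k <- sigma] ->
  m.+1 + i \notin [seq k.1 | k <- sigma] ->
  exists2 C : clause, C \in guarded m g trap &
    unit_under (blocks m) R C sigma (Some (m.+1 + i, true)).
Proof.
move=> im us small /(falsified_literal us)[b [b1 b2]].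
move=> /(falsified_literal us)[c [c1 c2]] na.
have na' e : (m.+1 + i, e) \notin sigma.
  by apply: contra na => H; apply/mapP; exists (m.+1 + i, e).
apply: (@hard_unit (xclause m i b c)) => //.
- by apply/hardP; left; exists i, b, c.
- by move=> l; rewrite in_xclause => /or3P[]/eqP ->.
- move=> l; rewrite in_xclause inE.
  case: (eqVneq l (i, b)) => [->|_].
    by rewrite /neg /= b1 xpair_eqE; lia.
  case: (eqVneq l (m, c)) => [->|_].
    by rewrite /neg /= c1 xpair_eqE; lia.
  by case: eqVneq => [->|//]; rewrite /neg /= na'.
- by move=> l [<-]; rewrite existentialE /=; split; lia.
Qed.

(** If all a_i are true, a long clause is falsified; otherwise a false a_i leaves one of the clauses
    for x_i falsified. *)
Lemma hard_conflict (sigma : seq lit) :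
  uniq [seq k.1 | k <- sigma] ->
  (forall l : lit, l \in sigma -> l.1 <= m.*2) ->
  (forall x, x <= m.*2 -> x \in [seq k.1 | k <- sigma]) ->
  exists2 C : clause, C \in guarded m g trap & unit_under (blocks m) R C sigma None.
Proof.
move=> us small tot.
have [c [c1 c2]] := falsified_literal us (tot m ltac:(lia)).
case: (boolP (all (fun y => (y, true) \in sigma) (iota m.+1 m))) => [/allP H|nH].
  have aT (l : lit) : (m < l.1 <= m.*2) && ~~ l.2 -> neg l \in sigma.
    by case: l => y [] /= /andP[ym] // _; apply: H; rewrite mem_iota /=; lia.
  apply: (@hard_unit (aclause m c)) => //.
  - by apply/hardP; right; exists c.
  - move=> l; rewrite in_aclause => /orP[/eqP -> //|/aT lT].
    by rewrite -(negK l); apply: uniq_var_consistent.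
  - move=> l; rewrite in_aclause inE.
    by apply/negP => /andP[/orP[/eqP ->|/aT ->]]; rewrite ?c1.
have [y + yF] : exists2 y : nat, y \in iota m.+1 m & (y, true) \notin sigma.
  exact/allPn.
rewrite mem_iota => ym; have [b|b] := var_in true (tot y ltac:(lia)).
  by rewrite b in yF.
have [d [d1 d2]] := falsified_literal us (tot (y - m.+1) ltac:(lia)).
have ey : m.+1 + (y - m.+1) = y by lia.
apply: (@hard_unit (xclause m (y - m.+1) d c)) => //.
- by apply/hardP; left; exists (y - m.+1), d, c; split=> //; lia.
- by move=> l; rewrite in_xclause ey => /or3P[]/eqP ->.
- move=> l; rewrite in_xclause ey inE; apply/negP => /andP[/or3P[]/eqP ->].
  + by rewrite d1.
  + by rewrite c1.
  + by rewrite b.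
Qed.

Lemma occurs_guarded x : x <= m.*2 ->
  exists2 C : clause, C \in guarded m g trap & exists2 l : lit, l \in C & l.1 = x.
Proof.
move=> xm; case: (ltnP x m) => xm'.
  exists (xclause m x true true `|` g).
    apply/in_guarded; left; exists (xclause m x true true) => //.
    by apply/hardP; left; exists x, true, true.
  by exists (x, true); rewrite // inE in_xclause eqxx.
exists (aclause m true `|` g).
  apply/in_guarded; left; exists (aclause m true) => //.
  by apply/hardP; right; exists true.
case: (eqVneq x m) => [->|xn].
  by exists (m, true); rewrite // inE in_aclause eqxx.
exists (x, false) => //; rewrite inE in_aclause.
have -> : m < (x, false).1 <= m.*2 by simpl; lia.
by rewrite orbT.
Qed.

(** * The order of assignments within a single trail *)

Section Trail.

Variables (phi : cnf) (W : {set {ffun 'I_m -> bool}}) (T : trail).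
Hypothesis phi_guarded : forall C : clause, C \in guarded m g trap -> C \in phi.
Hypothesis phi_types : forall C : clause,
  C \in phi -> [\/ xtype W C, gtype m C | C \in trap].
Hypothesis T_trail : is_trail (blocks m) R phi T.
Hypothesis T_natural : forall T1 d T2, T = T1 ++ Decide d :: T2 ->
  forall (C : clause) p, C \in guarded m g trap ->
  ~ unit_under (blocks m) R C (assignment T1) p.

(** LEV-ORD concerns only variables occurring in the clause set; each variable up to 2m does occur,
    in a hard clause. *)
Lemma assigned_before_decision T1 d T2 x : T = T1 ++ Decide d :: T2 ->
  x <= m.*2 -> lv (blocks m) x < lv (blocks m) d.1 -> x \in assigned T1.
Proof.
move=> eT xm ltx; have [_ ord] := trail_decide T_trail eT.
have [C CM [l lC lx]] := occurs_guarded xm.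
case: (boolP (x \in assigned T1)) => // nx.
have := ord C l (phi_guarded CM) lC; rewrite lx => /(_ nx); lia.
Qed.

Lemma uniq_prefix T1 T2 : T = T1 ++ T2 -> uniq (assigned T1).
Proof.
by case: T_trail => uT _ _ _ eT; move: uT; rewrite eT assigned_cat cat_uniq => /andP[].
Qed.

Lemma fresh_element T1 e T2 l : T = T1 ++ e :: T2 ->
  (step_element e).2 = Some l -> l.1 \notin assigned T1.
Proof.
move=> eT el; have := @uniq_prefix (rcons T1 e) T2; rewrite -cats1 -catA => /(_ eT).
rewrite assigned_cat cat_uniq => /and3P[_ /hasPn H _]; apply: H.
by rewrite /assigned /assignment /= el inE.
Qed.

Lemma mem_assigned_rcons T1 e (x : nat) : x \in assigned (rcons T1 e) ->
  x \in assigned T1 \/ exists2 l, (step_element e).2 = Some l & x = l.1.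
Proof.
rewrite /assigned assignment_rcons map_cat mem_cat => /orP[]; first by left.
by case: (step_element e).2 => [l|] //=; rewrite inE => /eqP ->; right; exists l.
Qed.

(** This is why w and t stay out of reach. Deciding one of them requires a total assignment of the
    earlier variables, which already falsifies a hard clause, against naturality. Propagating t
    would need a trap clause, but these are untouched by the trail so far and not unit by
    themselves. *)
Lemma assigned_small T1 T2 (x : nat) : T = T1 ++ T2 -> x \in assigned T1 -> x <= m.*2.
Proof.
elim/last_ind: T1 T2 x => [|T1 e IH] T2 x //.
rewrite cat_rcons => eT /mem_assigned_rcons[/(IH _ _ eT) //|[l el ->]].
have small (k : lit) : k \in assignment T1 -> k.1 <= m.*2.
  by move=> /assigned_mem; apply: IH eT.
case: e el eT => [d [<-]|p A /= ->] eT.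
  rewrite leqNgt; apply/negP => dm.
  have [|C CM CU] := hard_conflict (uniq_prefix eT) small.
    move=> y ym; apply: (assigned_before_decision eT ym).
    by rewrite !lvE; do !case: ifP => //; lia.
  exact: (T_natural eT CM CU).
have [/phi_types tA UA] := trail_propagate T_trail eT.
have [lA lE _] := unit_under_in UA.
case: tA => [[xA _]|[vA _ _ _]|tA]; first by have := xA _ lA; lia.
  by have := vA _ lA; move: lE; rewrite existentialE; lia.
case: UA => D rD uD; case: (trap_not_unit tA (p := Some l)).
suff -> : A = D by [].
have [_ inD] := restrictP rD; apply: clause_ext => k; rewrite inD.
case: (boolP (k \in A)) => //= kA; apply/esym/negP => /small.
by have := trap_vars tA kA; rewrite /=; lia.
Qed.

Lemma propagated_type T1 p A T2 : T = T1 ++ Propagate p A :: T2 ->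
  xtype W A \/ gtype m A.
Proof.
move=> eT; have [/phi_types tA [D rD uD]] := trail_propagate T_trail eT.
case: tA => tA; [by left | by right |].
case: (trap_not_unit tA (p := p)); suff -> : A = D by [].
have [_ inD] := restrictP rD; apply: clause_ext => k; rewrite inD.
case: (boolP (k \in A)) => //= kA; apply/esym/negP => /assigned_mem/(assigned_small eT).
by have := trap_vars tA kA; rewrite /=; lia.
Qed.

(** A decision outside x comes after all of x by LEV-ORD. A propagation outside x has an antecedent
    with a u-literal that cannot be reduced, so u was assigned earlier and the induction applies to
    it. *)
Lemma existentials_first T1 T2 (x y : nat) : T = T1 ++ T2 ->
  y \in assigned T1 -> m <= y -> x < m -> x \in assigned T1.
Proof.
elim/last_ind: T1 T2 y => [|T1 e IH] T2 y //; rewrite cat_rcons => eT yT ym xm.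
suff [z zT zm] : exists2 z, z \in assigned T1 & m <= z \/ z = x.
  rewrite /assigned assignment_rcons map_cat mem_cat; apply/orP; left.
  by case: zm => [zm|<- //]; apply: (IH _ z eT).
have [yT1|[l el yl]] := mem_assigned_rcons yT; first by exists y => //; left.
subst y; case: e el eT {yT} => [d [dl]|p A /= pl] eT;
  [subst d | subst p].
  exists x; last by right.
  apply: (assigned_before_decision eT); first by lia.
  by rewrite !lvE; do !case: ifP => //; lia.
have [_ UA] := trail_propagate T_trail eT; have [lA lE _] := unit_under_in UA.
case: (propagated_type eT) => [[xA _]|[_ [u uA um] _ _]].
  by have := xA _ lA; lia.
exists m; last by left.
case: (unit_under_low UA uA) => [|/assigned_mem|ul].
- by apply: lv_mono; lia.
- by rewrite /= um.
- by move: lE; rewrite -ul existentialE; lia.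
Qed.

(** At such a decision x_i and u are assigned by LEV-ORD, so a_i is already a unit and naturality
    demands its propagation. *)
Lemma decided_not_a T1 d T2 : T = T1 ++ Decide d :: T2 -> ~~ (m < d.1 <= m.*2).
Proof.
move=> eT; apply/negP => dm.
have ad : m.+1 + (d.1 - m.+1) = d.1 by lia.
have [| | | | | |C CM CU] := @hard_propagates (assignment T1) (d.1 - m.+1).
- by lia.
- exact: uniq_prefix eT.
- by move=> k /assigned_mem; apply: assigned_small eT.
- apply: (assigned_before_decision eT); first by lia.
  by rewrite !lvE; do !case: ifP => //; lia.
- apply: (assigned_before_decision eT); first by lia.
  by rewrite !lvE; do !case: ifP => //; lia.
- by rewrite ad; apply: (fresh_element eT).
exact: (T_natural eT CM CU).
Qed.

(** An unassigned x_i is read as false. This default does no harm, since a clause that newly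
    excludes the point mentions every x_i and is falsified by the trail. *)
Definition trail_point : {ffun 'I_m -> bool} :=
  [ffun i : 'I_m => (nat_of_ord i, true) \in assignment T].

Let W' := trail_point |: W.

(** Invariant of the leftward analysis with [T1] still to be read. As long as a-variables remain,
    all existential literals must be falsified within [T1]; afterwards only the excluded points
    matter. *)
Definition learn_inv (T1 : trail) (C : clause) : Prop :=
  xtype W' C \/ gtype m C /\
    (forall l : lit, l \in C -> existential (blocks m) l.1 ->
       neg l \in assignment T1).

(* Once no a-variable is left, probing forces every x_i into the clause, which
   therefore excludes the point of the trail only. *)
Lemma learn_inv_red T1 T2 C : T = T1 ++ T2 ->
  (forall l : lit, l \in C -> l.1 <= m.*2.+1) ->
  (exists2 l : lit, l \in C & l.1 = m) ->
  (forall i, i < m -> exists2 l : lit, l \in C & probe m i l) ->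
  (forall l : lit, l \in C -> existential (blocks m) l.1 ->
     neg l \in assignment T1) ->
  learn_inv T1 (red (blocks m) C).
Proof.
move=> eT vC uC pC fC.
case: (boolP (has (fun l : lit => m < l.1 <= m.*2) (enum_fset C)))
  => [/hasP[a aC am]|/hasPn na].
  right; split; last by move=> l /red_sub; apply: fC.
  by apply: red_gtype; split=> //; exists a.
(* Without a-variables the only existential literals are over x, so u and w lie to the right of all
   of them and are reduced. *)
have xC (l : lit) : l \in red (blocks m) C -> l.1 < m.
  move=> lr; have lC := red_sub lr; rewrite ltnNge; apply/negP => lm.
  have := na _ lC; have := vC _ lC => lw la.
  have lu : universal (blocks m) l.1 by rewrite universalE; lia.
  suff /negP : l \notin red (blocks m) C by [].
  apply: red_drop => // q qC; rewrite existentialE lv_lt_universal // => qE.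
  by have := na _ qC; have := vC _ qC; lia.
left; split=> // s; rewrite !inE negb_or => /andP[/eqP sT _].
have [i si] : exists i, s i != trail_point i.
  case: (pickP (fun i => s i != trail_point i)) => [i ?|H]; first by exists i.
  by case: sT; apply/ffunP => i; apply/eqP; have := H i => /negbFE.
have [l lC] := pC i (ltn_ord i); have := na _ lC => nl.
rewrite /probe (negPf nl) orbF => /eqP li; exists i.
have lE : existential (blocks m) l.1 by rewrite existentialE li ltn_ord.
(* The literal over x_i is falsified by the trail, hence opposite to [trail_point i], and so is the
   value [s i]. *)
suff -> : (nat_of_ord i, s i) = l.
  by apply: red_nonuniversal => //; rewrite universalE li; have := ltn_ord i; lia.
have nT : neg l \in assignment T by rewrite eT assignment_cat mem_cat fC.
have cT := uniq_var_consistent (uniq_prefix (esym (cats0 T))) nT.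
rewrite negK in cT; move: si; rewrite ffunE -li.
case: l {lC nl lE} li nT cT => x b /= -> nT cT.
by case: b nT cT => nT cT; [rewrite (negPf cT) | rewrite nT]; case: (s i).
Qed.

(** A falsifying decision would have to be on an x-variable. But the clause still has an a-literal,
    falsified earlier, and by then all of x is assigned. *)
Lemma learn_inv_decide T1 d T2 C : T = T1 ++ Decide d :: T2 ->
  learn_inv (rcons T1 (Decide d)) C -> learn_inv T1 C.
Proof.
move=> eT [xC|[gC fC]]; [by left | right; split=> // l lC lE].
have := fC l lC lE; rewrite assignment_rcons mem_cat => /orP[//|].
rewrite inE => /eqP nl; have dl : d.1 = l.1 by rewrite -nl.
have [a aC am] := gtype_a gC.
have aE : existential (blocks m) a.1 by rewrite existentialE; lia.
have := decided_not_a eT.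
have := assigned_small (T1 := rcons T1 (Decide d)) (T2 := T2) (x := d.1).
rewrite cat_rcons /assigned assignment_rcons map_cat mem_cat inE eqxx orbT.
move=> /(_ eT isT) dm da.
have dx : d.1 < m by move: lE; rewrite existentialE -dl; lia.
have := fC a aC aE; rewrite assignment_rcons mem_cat inE.
case/orP=> [/assigned_mem aT|/eqP ad].
  have := fresh_element eT erefl; rewrite (existentials_first eT aT) //=; lia.
by move: dx; rewrite -ad /=; lia.
Qed.

(** Pivots are separated: a clause with a-variables is resolved over a-variables only, and a clause
    over x only with antecedents over x. *)
Lemma learn_inv_propagate T1 p A T2 C : T = T1 ++ Propagate (Some p) A :: T2 ->
  learn_inv (rcons T1 (Propagate (Some p) A)) C ->
  learn_inv T1 (if neg p \in C then
    red (blocks m) (resolve p C (red (blocks m) A)) else C).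
Proof.
move=> eT LC; have [_ UA] := trail_propagate T_trail eT.
have [pA pE _] := unit_under_in UA; have fresh := fresh_element eT erefl.
(* An antecedent with an a-literal needs that literal falsified first, hence all of x assigned, so
   it cannot propagate an x-variable. *)
have xA : p.1 < m -> xtype W A.
  move=> pm; case: (propagated_type eT) => // -[_ _ [a aA am] _].
  have aU : ~~ universal (blocks m) a.1 by rewrite universalE; lia.
  case: (unit_under_nonuniversal UA aA aU) => [/assigned_mem aT|[ap]].
    by move: fresh; rewrite (existentials_first eT aT) //=; lia.
  by move: am pm; rewrite ap; lia.
case: ifPn => npC; last first.
  case: LC => [xC|[gC fC]]; [by left | right; split=> // l lC lE].
  have := fC l lC lE; rewrite assignment_rcons mem_cat => /orP[//|].
  by rewrite inE => /eqP nl; move: npC; rewrite -nl negK lC.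
case: LC => [xC|[gC fC]].
  have pm : p.1 < m by case: xC => /(_ _ npC).
  have xA' : xtype W' A by apply: xtypeS (xA pm); apply: subsetUr.
  have xR := resolve_xtype p xC xA'.
  by left; rewrite (red_xvars xA'.1) (red_xvars xR.1).
have fC' (l : lit) : l \in C -> existential (blocks m) l.1 -> l != neg p ->
    neg l \in assignment T1.
  move=> lC lE lp; have := fC l lC lE.
  rewrite assignment_rcons mem_cat => /orP[//|]; rewrite inE => /eqP nl.
  by move: lp; rewrite -nl negK eqxx.
have am : m < p.1 <= m.*2.
  have [a aC am] := gtype_a gC.
  have := gtype_vars gC npC => /= pv; move: pE; rewrite existentialE => pE.
  suff : ~~ (p.1 < m) by lia.
  apply/negP => pm; have aT : a.1 \in assigned T1.
    apply: (assigned_mem (l := neg a)); apply: fC' => //.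
      by rewrite existentialE; lia.
    by apply/eqP => ap; move: am; rewrite ap /=; lia.
  by move: fresh; rewrite (existentials_first eT aT) //=; lia.
have gA : gtype m (red (blocks m) A).
  case: (propagated_type eT) => [[/(_ _ pA)]|/red_gtype //]; lia.
apply: (learn_inv_red (T2 := Propagate (Some p) A :: T2)) => //.
- move=> l; rewrite in_resolve => /orP[]/andP[_].
    exact: (gtype_vars gC).
  exact: (gtype_vars gA).
- have [u uC um] := gtype_u gC; exists u => //; rewrite in_resolve uC andbT.
  by apply/orP; left; apply/eqP => up; move: um am; rewrite up /=; lia.
(* The two pivot literals are complementary over an a-variable and a probe contains only one of
   them, so one of the two premises keeps its probe literal. *)
- move=> i im; have [l lC lP] := gtype_probe gC im.
  have [k kA kP] := gtype_probe gA im.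
  case: (eqVneq l (neg p)) => [lp|lp]; last by exists l => //; rewrite in_resolve lp lC.
  case: (eqVneq k p) => [kp|kp]; last by exists k => //; rewrite in_resolve kp kA orbT.
  move: lP kP; rewrite lp kp /probe /= am.
  by case: (p.2); case: eqVneq => // ?; lia.
- move=> l; rewrite in_resolve => /orP[/andP[lp lC] lE|/andP[lp /red_sub lA] lE].
    exact: fC'.
  have lU : ~~ universal (blocks m) l.1.
    by move: lE; rewrite existentialE universalE; lia.
  by case: (unit_under_nonuniversal UA lA lU) => // -[pl]; rewrite pl eqxx in lp.
Qed.

Lemma learn_leftwards_inv T1 T2 C D : T = T1 ++ T2 -> learn_inv T1 C ->
  D \in learn_leftwards (blocks m) C (rev T1) -> xtype W' D \/ gtype m D.
Proof.
elim/last_ind: T1 T2 C => [|T1 e IH] T2 C //; rewrite cat_rcons rev_rcons => eT LC.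
case: e eT LC => [d|[p|] A] eT LC /=.
- exact: (IH _ C eT (learn_inv_decide eT LC)).
- have LC' := learn_inv_propagate eT LC.
  rewrite inE => /orP[/eqP ->|]; last exact: (IH _ _ eT).
  by case: LC' => [|[]]; [left|right].
- apply: (IH _ C eT); case: LC => [|[gC fC]]; [by left | right; split=> // l lC lE].
  by have := fC l lC lE; rewrite assignment_rcons cats0.
Qed.

(** The analysis starts at the conflict, whose antecedent has every existential literal falsified,
    so the invariant holds there. *)
Lemma learnable_types D : conflicting T -> D \in learnable (blocks m) T ->
  xtype W' D \/ gtype m D.
Proof.
case=> T1 [A eT]; rewrite /learnable {1}eT rev_rcons.
rewrite -cats1 in eT; have [_ UA] := trail_propagate T_trail eT.
have LA : learn_inv T1 (red (blocks m) A).
  case: (propagated_type eT) => [xA|[vA uA aA pA]].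
    by left; rewrite (red_xvars xA.1); apply: xtypeS xA; apply: subsetUr.
  apply: (learn_inv_red eT) => // l lA lE.
  have lU : ~~ universal (blocks m) l.1.
    by move: lE; rewrite existentialE universalE; lia.
  by case: (unit_under_nonuniversal UA lA lU).
rewrite inE => /orP[/eqP ->|]; last exact: learn_leftwards_inv eT LA.
by case: LA => [|[]]; [left|right].
Qed.

End Trail.

Lemma conflict_free_prefix phi T T1 e T2 : is_trail (blocks m) R phi T ->
  T = T1 ++ e :: T2 -> ~~ conflict_in T1.
Proof.
move=> [_ _ _ last] eT; apply/negP => /onthP[k].
rewrite /elements onth_map; case ek: (onth T1 k) => [[|p A]|] //= [p0].
rewrite p0 in ek; have kT1 : k < size T1 by rewrite -onthTE ek.
have := last k A; rewrite eT onth_cat kT1 ek size_cat /= => /(_ erefl); lia.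
Qed.

Lemma natural_no_decision phi T k T1 d T2 : is_trail (blocks m) R phi T ->
  natural_from (blocks m) R phi T k -> k <= size T1 ->
  T = T1 ++ Decide d :: T2 ->
  forall (C : clause) p, C \in phi ->
  ~ unit_under (blocks m) R C (assignment T1) p.
Proof.
move=> trT nat kT1 eT C p Cphi UC.
have := nat (size T1); rewrite /natural_at eT take_size_cat // size_cat kT1 leq_addr.
move=> /(_ isT (conflict_free_prefix trT eT)) [|q [A [+ _ _ _]]].
  by exists C, p.
by rewrite onth_cat ltnn subnn.
Qed.

(** * Counting the rounds of a refutation *)

Section Refutation.

Variables (Phi : qcnf) (P : seq round).
Hypothesis Phi_prefix : qprefix Phi = blocks m.
Hypothesis Phi_matrix : qmatrix Phi = guarded m g trap.
Hypothesis P_refutation : qcdcl_refutation R Phi P.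

Lemma round_valid i r : onth P i = Some r ->
  valid_round R (blocks m) (guarded m g trap `|` learned (take i P))
    (if i is j.+1 then onth P j else None) r.
Proof. by move=> ir; rewrite -Phi_prefix -Phi_matrix; apply: P_refutation.1. Qed.

(* Clauses of the matrix are unit in the part of a trail that is kept from the
   previous one exactly when they were unit there. *)
Lemma round_natural i r T1 d T2 : onth P i = Some r ->
  round_trail r = T1 ++ Decide d :: T2 ->
  forall (C : clause) p, C \in guarded m g trap ->
  ~ unit_under (blocks m) R C (assignment T1) p.
Proof.
elim: i r T1 d T2 => [|i IH] r T1 d T2 /[dup] ir /round_valid[trT _ _ nat] eT C p CM.
  by apply: (natural_no_decision trT nat _ eT); rewrite // inE CM.
have : i < size P by have : i.+1 < size P by [rewrite -onthTE ir]; lia.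
rewrite -onthTE; case ei: (onth P i) nat => [r'|] // [k [kT kT' eqk nat]] _.
case: (leqP k (size T1)) => kT1.
  by apply: (natural_no_decision trT nat _ eT); rewrite // inE CM.
have eT1 : elements (take (size T1) (round_trail r')) = elements T1.
  have := congr1 (take (size T1)) eqk.
  rewrite /elements -!map_take !take_takel; try lia.
  by rewrite eT take_size_cat.
have : onth (elements (take k (round_trail r'))) (size T1) = Some (true, Some d).
  by rewrite -eqk /elements onth_map onth_take // eT onth_cat ltnn subnn.
(* The decision lies in the shared initial segment, so it is made in the previous trail at the same
   place under the same assignment, and the induction descends to that round. *)
rewrite /elements onth_map onth_take //.
case ee: (onth (round_trail r') (size T1)) => [[d'|]|] //= [dd]; subst d'.
rewrite assignment_elements -eT1 -assignment_elements.
exact: (IH r' _ d _ ei (onth_split ee)).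
Qed.

(** Each round adds at most the point of its own trail; a learned clause that keeps an a-variable
    excludes nothing yet. *)
Lemma learned_types i : i <= size P ->
  exists2 W : {set {ffun 'I_m -> bool}}, #|W| <= i &
    forall C : clause, C \in learned (take i P) -> xtype W C \/ gtype m C.
Proof.
elim: i => [|i IH] iP.
  by exists set0; rewrite ?cards0 // => C; rewrite take0 inE.
have [W Wi HW] := IH (ltnW iP).
case ir: (onth P i) => [r|]; last by move: iP; rewrite -onthTE ir.
have [trT confT [pre [D eD]] _] := round_valid ir.
exists (trail_point (round_trail r) |: W); first by rewrite cardsU1; lia.
move=> C; rewrite (take_nth r) // (onth_nth r r P i ir) inE map_rcons mem_rcons inE.
case/orP=> [/eqP ->|CW]; last first.
  case: (HW C); first by rewrite inE.
    by move=> xC; left; apply: xtypeS xC; apply: subsetUr.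
  by right.
apply: (learnable_types (phi := guarded m g trap `|` learned (take i P))) => //.
- by move=> A AM; rewrite inE AM.
- move=> A; rewrite inE => /orP[/in_guarded[[h hh ->]|At]|/HW[]].
  + by constructor 2; apply: gtype_hard.
  + by constructor 3.
  + by constructor 1.
  + by constructor 2.
- by move=> T1 d T2 eT; apply: (round_natural ir eT).
- by case/prefixP: pre => s ->; rewrite mem_cat eD mem_rcons inE eqxx.
Qed.

Lemma refutation_rounds : 2 ^ m <= size P.
Proof.
have [W WP HW] := learned_types (leqnn _).
case: P_refutation => _ [P' [r [eP r0]]].
have : fset0 \in learned (take (size P) P).
  by rewrite take_size inE eP map_rcons r0 mem_rcons inE eqxx.
case/HW=> [[_ sW]|[_ [] //]].
have -> : 2 ^ m = #|[set: {ffun 'I_m -> bool}]|.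
  by rewrite cardsT card_ffun card_bool card_ord.
apply: leq_trans WP; apply/subset_leq_card/subsetP => s _; apply/negPn/negP => /sW[i].
by rewrite inE.
Qed.

Lemma refutation_size : 2 ^ m <= proof_size P.
Proof.
apply: (leq_trans refutation_rounds); apply: size_le_sum => i r /round_valid[_ + _ _].
by case=> T1 [A ->]; rewrite size_rcons.
Qed.

End Refutation.

End LowerBound.

(** * Polynomials against exponentials *)

Lemma horner_nat_mono (p : {poly nat}) x y : x <= y -> horner p x <= horner p y.
Proof.
move=> xy; elim/poly_ind: p => [|p c IH]; first by rewrite !horner0.
by rewrite !hornerE; apply: leq_add => //; apply: leq_mul.
Qed.

Lemma horner_nat_bound (p : {poly nat}) :
  exists c d, forall x, horner p x <= c * x.+1 ^ d.
Proof.
elim/poly_ind: p => [|p c [c' [d IH]]].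
  by exists 0, 0 => x; rewrite horner0.
exists (c' + c), d.+1 => x; rewrite !hornerE mulnDl; apply: leq_add.
  by rewrite expnSr mulnA; apply: leq_mul.
by rewrite leq_pmulr // expn_gt0.
Qed.

(** Induction on [d]: 2^n is split into two halves, of which one beats n^d by induction and the
    other absorbs the additional factor n. *)
Lemma exp_dominates c d : exists N, forall n, N <= n -> c * n ^ d < 2 ^ n.
Proof.
elim: d c => [|d IH] c.
  exists c => n cn; rewrite muln1; apply: leq_ltn_trans cn (ltn_expl _ _); lia.
(* The factor 2^(d+1) pays for replacing n by 2(n - n/2) in n^d and for n <= 2 * 2^(n/2). *)
have [N HN] := IH (c * 2 ^ d.+1); exists N.*2 => n nN.
have hn : N <= n - n./2 by lia.
have n2 : n <= 2 * (n - n./2) by lia.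
have -> : 2 ^ n = 2 ^ (n - n./2) * 2 ^ n./2 by rewrite -expnD; congr (2 ^ _); lia.
apply: (@leq_ltn_trans (c * 2 ^ d.+1 * (n - n./2) ^ d * 2 ^ n./2)); last first.
  by rewrite ltn_pmul2r ?expn_gt0 //; apply: HN.
have nh : n <= 2 * 2 ^ n./2.
  have := ltn_expl n./2 (isT : 1 < 2); lia.
have nd : n ^ d <= 2 ^ d * (n - n./2) ^ d.
  by rewrite -expnMn; case: (d) => // e; rewrite leq_exp2r.
have := leq_mul nd nh; rewrite -expnSr => /(leq_mul (leqnn c)).
by rewrite [2 ^ d.+1]expnSr; lia.
Qed.

Lemma superpoly_of_exp R (Phi : nat -> qcnf) :
  (forall n, qcnf_size (Phi n) <= 16 * n.+3 ^ 2) ->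
  (forall n P, qcdcl_refutation R (Phi n) P -> 2 ^ n.+1 <= proof_size P) ->
  superpoly_size_refutations R Phi.
Proof.
move=> small hard q; have [c [d qB]] := horner_nat_bound q.
(* The 4 turns 2^(n+3) into 2^(n+1), 17 is 16 plus one for the successor in [horner_nat_bound], and
   the exponent doubles because sizes are quadratic. *)
have [N HN] := exp_dominates (4 * c * 17 ^ d) (2 * d).
exists N => n nN P /hard; apply: leq_trans.
have := HN n.+3 ltac:(lia); rewrite !expnS => lt.
suff : horner q (qcnf_size (Phi n)) <= c * 17 ^ d * n.+3 ^ (2 * d).
  by move: lt; lia.
apply: (leq_trans (qB _)); rewrite -mulnA leq_mul2l; apply/orP; right.
rewrite expnM -expnMn; case: (d) => // e; rewrite leq_exp2r //.
by have := small n; rewrite expnS expn1; lia.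
Qed.

(** A simulation by [p] composed with the upper bound [p0] would give refutations below a polynomial
    of the formula size. *)
Lemma separation_not_simulates R R' (Phi : nat -> qcnf) :
  poly_size_refutations R Phi -> superpoly_size_refutations R' Phi ->
  ~ simulates R' R.
Proof.
move=> [p0 easy] hard [p sim]; have [N /(_ N (leqnn N)) HN] := hard (p \Po p0)%R.
have [P PR Psize] := easy N; have [P' /HN] := sim _ _ PR.
rewrite horner_comp => lt le; move: lt; rewrite ltnNge => /negP; apply.
by apply: (leq_trans le); apply: horner_nat_mono.
Qed.

(** * Upper bounds *)

Lemma not_tautological (f : nat -> bool) (C : clause) :
  (forall l : lit, l \in C -> l.2 = f l.1) -> ~~ tautological C.
Proof.
move=> fC; apply/hasPn => l lC; apply/negP => /fC /=; rewrite -(fC l lC).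
by case: (l.2).
Qed.

Lemma blocks_nonempty m : 0 < m -> all (fun B : block => B.2 != fset0) (blocks m).
Proof.
move=> m0; have ne lo k : 0 < k -> varange lo k != fset0.
  by move=> k0; apply/fset0Pn; exists lo; rewrite in_varange; lia.
by rewrite /= !ne.
Qed.

Lemma blocks_disjoint m :
  pairwise (fun B B' : block => [disjoint B.2 & B'.2]) (blocks m).
Proof.
have dj lo k lo' k' : lo + k <= lo' -> [disjoint varange lo k & varange lo' k'].
  by move=> le; apply/fdisjointP => x; rewrite !in_varange; lia.
by rewrite /= !dj //; lia.
Qed.

Lemma blocks_bound m x : x <= m.*2.+2 -> bound (blocks m) x.
Proof. by rewrite /bound /= !in_varange; lia. Qed.

(** * The guarded formulas as QCNFs, and their size *)

Section Formula.

Variables (m : nat) (g : clause) (trap : seq clause).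
Hypothesis m_gt0 : 0 < m.
Hypothesis guard_lit : forall l : lit, l \in g -> l = (m.*2.+1, false).
Hypothesis trap_vars : forall (C : clause) (l : lit),
  C \in trap -> l \in C -> l.1 <= m.*2.+2.
Hypothesis trap_nontaut : forall C : clause, C \in trap -> ~~ tautological C.

Lemma guarded_vars (C : clause) (l : lit) :
  C \in guarded m g trap -> l \in C -> l.1 <= m.*2.+2.
Proof.
case/in_guarded=> [[h hh ->]|/trap_vars]; last exact.
have gv (k : lit) : k \in g -> k.1 = m.*2.+1 by move=> /guard_lit ->.
by move=> /(gtype_vars (gtype_hard m_gt0 gv hh)); lia.
Qed.

Lemma guarded_closed (C : clause) (l : lit) : C \in guarded m g trap ->
  l \in C -> has (fun B : block => l.1 \in B.2) (blocks m).
Proof. by move=> CM lC; apply: blocks_bound; apply: guarded_vars lC. Qed.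

Lemma guarded_nontaut (C : clause) : C \in guarded m g trap -> ~~ tautological C.
Proof.
case/in_guarded=> [[h /hardP[[i [b [c [im ->]]]]|[c ->]] ->]|/trap_nontaut //].
  apply: (@not_tautological (fun x => if x == i then b else
    if x == m then c else x <= m.*2)) => l.
  rewrite inE in_xclause => /orP[/or3P[]/eqP ->|/guard_lit ->] /=.
  - by rewrite eqxx.
  - by rewrite eqxx ifN //; lia.
  - by rewrite !ifN; lia.
  - by rewrite !ifN; lia.
apply: (@not_tautological (fun x => (x == m) && c)) => l.
rewrite inE in_aclause => /orP[/orP[/eqP ->|/andP[lm /negPf ->]]|/guard_lit ->] /=.
- by rewrite eqxx.
- by rewrite (_ : (_ == m) = false) //; lia.
- by rewrite (_ : (_ == m) = false) //; lia.
Qed.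

Definition guarded_qcnf : qcnf :=
  QCNF (blocks_nonempty m_gt0) (blocks_disjoint m) isT guarded_closed
    guarded_nontaut.

Lemma blocks_size : \sum_(B <- blocks m) #|` B.2| = m.*2 + 3.
Proof.
have sz lo k : #|` varange lo k| = k.
  by rewrite card_fseq undup_id ?iota_uniq // size_iota.
by rewrite !big_cons big_nil /= !sz; lia.
Qed.

Lemma clause_size (C : clause) : C \in guarded m g trap -> #|` C| <= m * 4 + 6.
Proof.
move=> CM; pose s : seq lit := [seq (y, true) | y <- iota 0 m.*2.+3] ++
  [seq (y, false) | y <- iota 0 m.*2.+3].
have : C `<=` [fset l in s].
  apply/fsubsetP => -[x b] lC; rewrite in_fset /s mem_cat.
  have xI : x \in iota 0 m.*2.+3 by rewrite mem_iota add0n ltnS (guarded_vars CM lC).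
  by case: b {lC}; rewrite (map_f (fun y => (y, _))) ?orbT.
move=> /fsubset_leq_card/leq_trans; apply; rewrite card_fseq.
by apply: leq_trans (size_undup _) _; rewrite size_cat !size_map !size_iota; lia.
Qed.

Lemma guarded_card : #|` guarded m g trap| <= m * 4 + 2 + size trap.
Proof.
rewrite card_fseq; apply: leq_trans (size_undup _) _.
rewrite size_cat size_map size_cat size_flatten /shape -map_comp /=.
suff -> : sumn [seq 4 | i <- iota 0 m] = m * 4 by [].
by rewrite sumnE big_map big_const_seq count_predT size_iota iter_addn_0 mulnC.
Qed.

(** The left inequality lets linear-length trails count as polynomial; the right one is for the
    comparison with 2^m. *)
Lemma guarded_qcnf_size : size trap <= 2 ->
  m.*2 + 3 <= qcnf_size guarded_qcnf <= 16 * m.+2 ^ 2.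
Proof.
move=> t2; rewrite /qcnf_size /= blocks_size leq_addr /=.
suff H : \sum_(C <- guarded m g trap) (#|` C|).+1 <= (m * 4 + 4) * (m * 4 + 7).
  by apply: (leq_trans (leq_add (leqnn _) H)); rewrite expnS expn1; lia.
apply: (@leq_trans (\sum_(C <- guarded m g trap) (m * 4 + 7))).
  rewrite big_seq [leqRHS]big_seq; apply: leq_sum => C /clause_size; lia.
rewrite big_const_seq count_predT iter_addn_0 mulnC leq_mul2r; apply/orP; right.
by apply: (leq_trans guarded_card); lia.
Qed.

End Formula.

(** For falsity it is enough that the universal player answers w = 0, as the trap clauses then fail
    on their own. *)
Lemma qtrue_blocks m phi s : qtrue_under (blocks m) phi s ->
  exists2 s' : nat -> bool, s' m.*2.+1 = false &
    forall C : clause, C \in phi -> exists2 l : lit, l \in C & s' l.1 = l.2.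
Proof.
case=> s1 [_ /(_ s1 (fun _ _ => erefl))[s3 [_ H]]].
have [x xn|s5 [e5 s5phi]] := H (fun x => (x != m.*2.+1) && s3 x).
  by rewrite (_ : x != _) //; move: xn; rewrite in_varange; lia.
exists s5 => //; rewrite e5 ?eqxx // in_varange; lia.
Qed.

Lemma single_round_refutation R (Phi : qcnf) T D :
  is_trail (qprefix Phi) R (qmatrix Phi) T -> conflicting T ->
  prefix (rcons D fset0) (learnable (qprefix Phi) T) ->
  natural_from (qprefix Phi) R (qmatrix Phi) T 0 ->
  qcdcl_refutation R Phi [:: Round T fset0 (rcons D fset0)].
Proof.
move=> trT cT pT nT; split; last by exists [::], (Round T fset0 (rcons D fset0)).
move=> i r /onth1P[-> <-].
have -> : qmatrix Phi `|` learned (take 0 [:: Round T fset0 (rcons D fset0)]) =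
    qmatrix Phi.
  by apply/fsetP => C; rewrite take0 !inE orbF.
by split=> //; split=> //; exists D.
Qed.

(** * The two families and their falsity *)

Definition wt_clause (m : nat) (b : bool) : clause :=
  [fset (m.*2.+1, true); (m.*2.+2, b)].

Definition wt_trap (m : nat) : seq clause := [:: wt_clause m true; wt_clause m false].
Definition w_guard (m : nat) : clause := [fset (m.*2.+1, false)].
Definition w_trap (m : nat) : seq clause := [:: [fset (m.*2.+1, true)]].

Lemma in_wt_clause m b (l : lit) :
  (l \in wt_clause m b) = (l == (m.*2.+1, true)) || (l == (m.*2.+2, b)).
Proof. by rewrite !inE. Qed.

Lemma wt_trapP m C : C \in wt_trap m -> exists b, C = wt_clause m b.
Proof. by rewrite !inE => /orP[]/eqP ->; [exists true | exists false]. Qed.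

Lemma wt_trap_vars m (C : clause) (l : lit) :
  C \in wt_trap m -> l \in C -> m.*2 < l.1 <= m.*2.+2.
Proof. by case/wt_trapP=> b ->; rewrite in_wt_clause => /orP[]/eqP -> /=; lia. Qed.

Lemma w_trap_vars m (C : clause) (l : lit) :
  C \in w_trap m -> l \in C -> m.*2 < l.1 <= m.*2.+2.
Proof. by rewrite inE => /eqP ->; rewrite inE => /eqP -> /=; lia. Qed.

Lemma wt_trap_nontaut m (C : clause) : C \in wt_trap m -> ~~ tautological C.
Proof.
case/wt_trapP=> b ->; apply: (@not_tautological (fun x => (x == m.*2.+1) || b)) => l.
rewrite in_wt_clause => /orP[]/eqP -> /=; first by rewrite eqxx.
by rewrite (_ : (_ == _) = false) //; lia.
Qed.

Lemma w_trap_nontaut m (C : clause) : C \in w_trap m -> ~~ tautological C.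
Proof.
rewrite inE => /eqP ->; apply: (@not_tautological (fun=> true)) => l.
by rewrite inE => /eqP ->.
Qed.

Lemma w_guard_lit m (l : lit) : l \in w_guard m -> l = (m.*2.+1, false).
Proof. by rewrite inE => /eqP. Qed.

Lemma no_guard_lit m (l : lit) : l \in (fset0 : clause) -> l = (m.*2.+1, false).
Proof. by rewrite inE. Qed.

Definition easy_no_red (n : nat) : qcnf :=
  guarded_qcnf (ltn0Sn n) (@w_guard_lit n.+1)
    (fun C l Ct lC => (proj2 (andP (wt_trap_vars Ct lC))))
    (@wt_trap_nontaut n.+1).

Definition easy_red (n : nat) : qcnf :=
  guarded_qcnf (ltn0Sn n) (@no_guard_lit n.+1)
    (fun C l Ct lC => (proj2 (andP (w_trap_vars Ct lC))))
    (@w_trap_nontaut n.+1).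

Lemma easy_no_red_false n : qfalse (easy_no_red n).
Proof.
move=> /qtrue_blocks[s sw sphi].
have H b : s n.+1.*2.+2 = b.
  have [|l] := sphi (wt_clause n.+1 b).
    by apply/in_guarded; right; case: b; rewrite !inE eqxx ?orbT.
  by rewrite in_wt_clause => /orP[]/eqP -> //=; rewrite sw.
by have := H true; rewrite (H false).
Qed.

Lemma easy_red_false n : qfalse (easy_red n).
Proof.
move=> /qtrue_blocks[s sw sphi].
have [|l] := sphi [fset (n.+1.*2.+1, true)].
  by apply/in_guarded; right; rewrite inE.
by rewrite inE => /eqP -> /=; rewrite sw.
Qed.

(** The clause (w) has no existential literal, so it reduces to the empty clause and gives a
    conflict before any decision. *)
Lemma easy_red_refutation n :
  qcdcl_refutation RED (easy_red n) [:: Round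
    [:: Propagate None [fset (n.+1.*2.+1, true)]] fset0 [:: fset0]].
Proof.
set m := n.+1; pose C : clause := [fset (m.*2.+1, true)].
have CM : C \in guarded m fset0 (w_trap m) by apply/in_guarded; right; rewrite inE.
have redC : red (blocks m) C = fset0.
  apply: clause_ext => l; rewrite [RHS]inE; apply/negP => /[dup] /red_sub.
  rewrite inE => /eqP ->; apply/negP; apply: red_drop.
    by rewrite universalE eqxx orbT.
  by move=> q; rewrite inE => /eqP ->; rewrite existentialE /=; lia.
have UC : unit_under (blocks m) RED C [::] None.
  by exists C => //; apply: restrict_eq => // l; rewrite andbT.
apply: (single_round_refutation (D := [::])).
- split=> //.
  + by move=> k d /onth1P[].
  + by move=> k p A /onth1P[-> [<- <-]].
  + by move=> k A /onth1P[->].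
- by exists [::], C.
- by rewrite /= redC eqxx.
- by move=> [|[|j]] // _; rewrite /natural_at /= => // _ _; exists None, C.
Qed.

(** * The short refutation without reduction *)

Definition decisions (k : nat) : trail := [seq Decide (y, true) | y <- iota 0 k].

Lemma assignment_decisions k :
  assignment (decisions k) = [seq (y, true) | y <- iota 0 k].
Proof. by rewrite /decisions /assignment; elim: (iota 0 k) => //= y s ->. Qed.

Definition easy_no_red_trail (m : nat) : trail :=
  decisions m.*2.+1 ++ [:: Decide (m.*2.+1, false);
    Propagate (Some (m.*2.+2, true)) (wt_clause m true);
    Propagate None (wt_clause m false)].

Section EasyNoRed.

Variable m : nat.
Let T := easy_no_red_trail m.
Let phi := guarded m (w_guard m) (wt_trap m).

Let size_decisions k : size (decisions k) = k.
Proof. by rewrite size_map size_iota. Qed.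

Lemma take_decisions k : k <= m.*2.+1 -> take k T = decisions k.
Proof.
move=> km; rewrite takel_cat ?size_decisions //.
by rewrite /decisions -map_take take_iota; congr (map _ (iota _ _)); lia.
Qed.

Lemma take_past k : take (m.*2.+1 + k) T = decisions m.*2.+1 ++ take k
  [:: Decide (m.*2.+1, false);
      Propagate (Some (m.*2.+2, true)) (wt_clause m true);
      Propagate None (wt_clause m false)].
Proof. by rewrite take_cat size_decisions ltnNge leq_addr addKn. Qed.

Lemma onth_past k : onth T (m.*2.+1 + k) = onth
  [:: Decide (m.*2.+1, false);
      Propagate (Some (m.*2.+2, true)) (wt_clause m true);
      Propagate None (wt_clause m false)] k.
Proof. by rewrite onth_cat size_decisions ltnNge leq_addr addKn. Qed.

Lemma onth_decisions k : k < m.*2.+1 -> onth T k = Some (Decide (k, true)).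
Proof.
move=> km; rewrite onth_cat size_decisions km onth_map.
suff -> : onth (iota 0 m.*2.+1) k = Some k by [].
by rewrite onthE (nth_map 0) ?size_iota // nth_iota.
Qed.

Lemma trap_in_phi b : wt_clause m b \in phi.
Proof. by apply/in_guarded; right; case: b; rewrite !inE eqxx ?orbT. Qed.

Let sigma_w : seq lit :=
  [seq (y, true) | y <- iota 0 m.*2.+1] ++ [:: (m.*2.+1, false)].

Lemma in_sigma_w (l : lit) :
  (l \in sigma_w) = (l.1 < m.*2.+1) && l.2 || (l == (m.*2.+1, false)).
Proof.
rewrite mem_cat mem_seq1; congr orb; apply/mapP/andP => [[y + ->]|[l1 l2]].
  by rewrite mem_iota.
by exists l.1; [rewrite mem_iota | case: l l2 {l1} => x []].
Qed.

Lemma unit_t : unit_under (blocks m) NO_RED (wt_clause m true) sigma_w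
  (Some (m.*2.+2, true)).
Proof.
exists [fset (m.*2.+2, true)]; last first.
  by split=> // l [<-]; rewrite existentialE eqxx orbT.
apply: restrict_eq => l.
  by rewrite in_wt_clause in_sigma_w => /orP[]/eqP -> /=; rewrite xpair_eqE; lia.
rewrite inE in_wt_clause in_sigma_w.
case: (eqVneq l (m.*2.+1, true)) => [->|_] /=.
  by rewrite /neg /= eqxx orbT /= xpair_eqE; lia.
case: eqVneq => [->|//]; rewrite /neg /= xpair_eqE; lia.
Qed.

Lemma unit_bot : unit_under (blocks m) NO_RED (wt_clause m false)
  (sigma_w ++ [:: (m.*2.+2, true)]) None.
Proof.
exists fset0 => //; apply: restrict_eq => l.
  rewrite in_wt_clause mem_cat in_sigma_w inE.
  by move=> /orP[]/eqP -> /=; rewrite !xpair_eqE; lia.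
rewrite [LHS]inE; apply/esym/negP.
rewrite in_wt_clause mem_cat in_sigma_w inE => /andP[/orP[]/eqP ->];
  by rewrite /neg /= eqxx ?orbT.
Qed.

Lemma guarded_w (C : clause) : C \in phi -> exists2 l : lit, l \in C & l.1 = m.*2.+1.
Proof.
case/in_guarded=> [[h _ ->]|/wt_trapP[b ->]].
  by exists (m.*2.+1, false); rewrite // !inE eqxx orbT.
by exists (m.*2.+1, true); rewrite // in_wt_clause eqxx.
Qed.

(** Every clause contains a literal over the universal w, which stays until w is assigned; a unit
    must be existential or empty. *)
Lemma not_unit_before_w (C : clause) p k : k <= m.*2.+1 -> C \in phi ->
  ~ unit_under (blocks m) NO_RED C [seq (y, true) | y <- iota 0 k] p.
Proof.
move=> km /guarded_w[l lC lw] [D /restrictP[_ inD] [eD pE]].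
have : l \in D.
  by rewrite inD lC; apply/mapP => -[y]; rewrite mem_iota => yk [yw _]; lia.
rewrite (eD : D = _); case: p {eD} pE => [q|] pE; rewrite inE // => /eqP lq.
by have := pE q erefl; rewrite -lq existentialE lw; lia.
Qed.

(** Setting w = 0 satisfies all guarded clauses, and the trap clauses still contain t. *)
Lemma not_bot_after_w (C : clause) : C \in phi ->
  ~ unit_under (blocks m) NO_RED C sigma_w None.
Proof.
move=> CM [D /restrictP[nC inD] [/= eD _]].
case/in_guarded: CM => [[h _ eC]|/wt_trapP[b eC]].
  have /nC : (m.*2.+1, false) \in C by rewrite eC !inE eqxx orbT.
  by rewrite in_sigma_w eqxx orbT.
have : (m.*2.+2, b) \in D.
  by rewrite inD eC in_wt_clause eqxx orbT in_sigma_w /neg /= xpair_eqE; lia.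
by rewrite eD inE.
Qed.

Let assignment_w : assignment (take (m.*2.+1 + 1) T) = sigma_w.
Proof. by rewrite take_past assignment_cat assignment_decisions. Qed.

Let assignment_wt :
  assignment (take (m.*2.+1 + 2) T) = sigma_w ++ [:: (m.*2.+2, true)].
Proof. by rewrite take_past assignment_cat assignment_decisions /= -catA. Qed.

Lemma assigned_decisions k : k <= m.*2.+1 -> assigned (take k T) = iota 0 k.
Proof.
by move=> km; rewrite take_decisions // /assigned assignment_decisions -map_comp map_id.
Qed.

Lemma decided k d : onth T k = Some (Decide d) -> d.1 = k /\ k <= m.*2.+1.
Proof.
case: (ltnP k m.*2.+1) => km; first by rewrite onth_decisions // => -[<-] /=; lia.
rewrite -(subnKC km) onth_past; case: (k - _) => [|[|[|[|j]]]] //= [<-] /=; lia.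
Qed.

Lemma propagated k p A : onth T k = Some (Propagate p A) ->
  [/\ k = m.*2.+1 + 1, p = Some (m.*2.+2, true) & A = wt_clause m true] \/
  [/\ k = m.*2.+1 + 2, p = None & A = wt_clause m false].
Proof.
case: (ltnP k m.*2.+1) => km; first by rewrite onth_decisions.
rewrite -(subnKC km) onth_past.
by case: (k - _) => [|[|[|[|j]]]] //= [<- <-]; [left|right].
Qed.

Lemma easy_no_red_is_trail : is_trail (blocks m) NO_RED phi T.
Proof.
split.
- rewrite /T /easy_no_red_trail assigned_cat.
  rewrite (_ : assigned _ = iota 0 m.*2.+1); last first.
    by rewrite /assigned assignment_decisions -map_comp map_id.
  (* Since w and t continue the numbering, the trail assigns the variables 0 to 2m+2 in order. *)
  by rewrite -[X in _ ++ X]/(iota (0 + m.*2.+1) 2) -iotaD iota_uniq.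
- move=> k d /decided[dk km]; split; first by apply: blocks_bound; lia.
  move=> C l _ _; rewrite assigned_decisions // mem_iota dk => kl.
  by apply: lv_mono; lia.
- move=> k p A /propagated[][-> -> ->]; split; try exact: trap_in_phi.
    by rewrite assignment_w; apply: unit_t.
  by rewrite assignment_wt; apply: unit_bot.
- move=> k A /propagated[][-> // _ _].
  by rewrite size_cat size_decisions /=; lia.
Qed.

Lemma easy_no_red_natural : natural_from (blocks m) NO_RED phi T 0.
Proof.
move=> j /andP[_ jT]; rewrite /natural_at.
case: (leqP j m.*2.+1) => jm.
  rewrite take_decisions // assignment_decisions => _ [C [p [CM UC]]].
  by case: (not_unit_before_w jm CM UC).
have {jm jT} [->|->|->] : [\/ j = m.*2.+1 + 1, j = m.*2.+1 + 2 | j = m.*2.+1 + 3].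
- move: jT; rewrite size_cat size_decisions /= => jT.
  case: (eqVneq j (m.*2.+1 + 1)) => [|?]; first by constructor 1.
  case: (eqVneq j (m.*2.+1 + 2)) => [|?]; first by constructor 2.
  by constructor 3; lia.
- rewrite assignment_w onth_past => _ _.
  exists (Some (m.*2.+2, true)), (wt_clause m true).
  split=> //; [exact: trap_in_phi | exact: unit_t |].
  by case=> C CM UC; case: (not_bot_after_w CM UC).
- rewrite assignment_wt onth_past => _ _; exists None, (wt_clause m false).
  by split=> //; [exact: trap_in_phi | exact: unit_bot].
(* The whole trail already contains the conflict, so the condition is vacuous. *)
- by rewrite take_past /conflict_in /elements map_cat mem_cat !inE /= eqxx ?orbT.
Qed.

Lemma red_wt_clause b : red (blocks m) (wt_clause m b) = wt_clause m b.
Proof.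
apply: clause_ext => l; apply/idP/idP => [/red_sub //|lC].
apply: (red_blocked lC (q := (m.*2.+2, b))).
- by rewrite in_wt_clause eqxx orbT.
- by rewrite existentialE eqxx orbT.
- by apply: lv_mono; move: lC; rewrite in_wt_clause => /orP[]/eqP ->.
Qed.

(** In both clauses t blocks w. Resolving over t leaves (w), and learning reduces it even when
    propagation does not. *)
Lemma easy_no_red_learns :
  prefix [:: wt_clause m false; fset0] (learnable (blocks m) T).
Proof.
rewrite /learnable /T /easy_no_red_trail rev_cat /= !red_wt_clause.
rewrite prefix0s eqxx andbT /=.
have -> : neg (m.*2.+2, true) \in wt_clause m false.
  by rewrite in_wt_clause /neg eqxx orbT.
suff -> : red (blocks m) (resolve (m.*2.+2, true) (wt_clause m false)
    (wt_clause m true)) = fset0 by [].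
apply: clause_ext => l; rewrite [RHS]inE; apply/negP => /[dup] /red_sub.
have rw (k : lit) : k \in resolve (m.*2.+2, true) (wt_clause m false)
    (wt_clause m true) -> k = (m.*2.+1, true).
  rewrite in_resolve !in_wt_clause /neg /=.
  by case: (k == (m.*2.+1, true)) / eqP => //= _; rewrite !andNb.
move=> /rw ->; apply/negP; apply: red_drop.
  by rewrite universalE eqxx orbT.
by move=> q /rw ->; rewrite existentialE /=; lia.
Qed.

End EasyNoRed.

Lemma easy_no_red_refutation n : qcdcl_refutation NO_RED (easy_no_red n)
  [:: Round (easy_no_red_trail n.+1) fset0 [:: wt_clause n.+1 false; fset0]].
Proof.
apply: (single_round_refutation (D := [:: wt_clause n.+1 false])).
- exact: easy_no_red_is_trail.
- exists (decisions n.+1.*2.+1 ++ [:: Decide (n.+1.*2.+1, false);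
    Propagate (Some (n.+1.*2.+2, true)) (wt_clause n.+1 true)]).
  by exists (wt_clause n.+1 false); rewrite -cats1 -catA.
- exact: easy_no_red_learns.
- exact: easy_no_red_natural.
Qed.

(** * Upper and lower bounds for the two families *)

Lemma easy_no_red_poly : poly_size_refutations NO_RED easy_no_red.
Proof.
(* The trail has 2m+4 elements, one more than the lower bound 2m+3 on the formula size. *)
exists ('X + 1%:P)%R => n; exists [:: Round (easy_no_red_trail n.+1) fset0
  [:: wt_clause n.+1 false; fset0]]; first exact: easy_no_red_refutation.
rewrite !hornerE /proof_size big_seq1 /= size_cat size_map size_iota /=.
have /andP[+ _] := @guarded_qcnf_size n.+1 _ _ (ltn0Sn n) (@w_guard_lit n.+1)
  (fun C l Ct lC => proj2 (andP (wt_trap_vars Ct lC))) (@wt_trap_nontaut n.+1) isT.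
by rewrite -/(easy_no_red n); lia.
Qed.

Lemma easy_red_poly : poly_size_refutations RED easy_red.
Proof.
exists ('X + 1%:P)%R => n; eexists; first exact: easy_red_refutation.
rewrite !hornerE /proof_size big_seq1 /=; lia.
Qed.

Lemma easy_no_red_hard : superpoly_size_refutations RED easy_no_red.
Proof.
apply: superpoly_of_exp => [n|n P PR].
  by have /andP[] := @guarded_qcnf_size n.+1 _ _ (ltn0Sn n) (@w_guard_lit n.+1)
    (fun C l Ct lC => proj2 (andP (wt_trap_vars Ct lC))) (@wt_trap_nontaut n.+1) isT.
apply: (@refutation_size RED n.+1 (w_guard n.+1) (wt_trap n.+1) _ _ _ _ _
  (easy_no_red n)) => //.
- by move=> l /w_guard_lit ->.
- by move=> C l Ct lC; have /andP[] := wt_trap_vars Ct lC.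
(* Here t blocks the reduction of w, so a trap clause keeps two literals. *)
- move=> C p /wt_trapP[b ->] [/=]; rewrite red_wt_clause.
  case: p => [q|] /fsetP eC _.
    have := eC (n.+1.*2.+1, true); have := eC (n.+1.*2.+2, b).
    rewrite !in_wt_clause !inE !eqxx orbT /= => /esym/eqP <- /esym/eqP [].
    by lia.
  by have := eC (n.+1.*2.+1, true); rewrite in_wt_clause eqxx inE.
Qed.

Lemma easy_red_hard : superpoly_size_refutations NO_RED easy_red.
Proof.
apply: superpoly_of_exp => [n|n P PR].
  by have /andP[] := @guarded_qcnf_size n.+1 _ _ (ltn0Sn n) (@no_guard_lit n.+1)
    (fun C l Ct lC => proj2 (andP (w_trap_vars Ct lC))) (@w_trap_nontaut n.+1) isT.
apply: (@refutation_size NO_RED n.+1 fset0 (w_trap n.+1) _ _ _ _ _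
  (easy_red n)) => //.
- by move=> C l Ct lC; have /andP[] := w_trap_vars Ct lC.
(* Without reduction (w) is no unit, because w is universal. *)
- move=> C p; rewrite inE => /eqP -> [eC].
  have : (n.+1.*2.+1, true) \in clause_of_element p by rewrite -eC inE.
  case: p {eC} => [q|]; rewrite inE // => /eqP <- /(_ _ erefl).
  by rewrite existentialE /=; lia.
Qed.

Theorem theorem8p4 :
  (~ simulates NO_RED RED /\ ~ simulates RED NO_RED) /\
  (exists Phi : nat -> qcnf,
     (forall n : nat, qfalse (Phi n)) /\
     poly_size_refutations RED Phi /\ superpoly_size_refutations NO_RED Phi) /\
  (exists Phi : nat -> qcnf,
     (forall n : nat, qfalse (Phi n)) /\
     poly_size_refutations NO_RED Phi /\ superpoly_size_refutations RED Phi).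
Proof.
have [rp rh] := (easy_red_poly, easy_red_hard).
have [np nh] := (easy_no_red_poly, easy_no_red_hard).
split.
  by split; [apply: separation_not_simulates rp rh |
             apply: separation_not_simulates np nh].
split; first by exists easy_red; split; [exact: easy_red_false | split].
by exists easy_no_red; split; [exact: easy_no_red_false | split].
Qed.
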